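(* Let $L\ge 1$ be an integer and for $x\in\{1,\dots,L\}$ let $c_x:\mathbb{N}\to[0,\infty)$ satisfy $c_x(0)=0$ and $c_x(n)>0$ for $n>0$. Assume that there exist $0\le\delta<c$ such that for every $x\in\{1,\dots,L\}$ and every $n\ge 0$ $$c\le c_x(n+1)-c_x(n)\le c+\delta .$$ For $N\in\mathbb{N}$ consider the zero-range process on $S_N=\{\eta\in\mathbb{N}^L:\sum_x\eta_x=N\}$ with generator $$\mathcal{L}f(\eta)=\frac1L\sum_{x,y=1}^L c_x(\eta_x)\nabla_{xy}f(\eta)$$ and reversible measure $\pi=\pi_N$. Then, for every $L$, every $N$ and every $f:S_N\to(0,\infty)$, $$(c-\delta)\,\mathcal{E}(f,\log f)\le\pi\big[\mathcal{L}f\,\mathcal{L}\log f\big]+\pi\Big[\frac{(\mathcal{L}f)^2}{f}\Big],$$ and in particular $$(c-\delta)\,\mathrm{Ent}_\pi(f)\le\mathcal{E}(f,\log f).$$ (The constant $c-\delta$ does not depend on the number $L$ of vertices or the number $N$ of particles.)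
   Context: $\mathbb{N}=\{0,1,2,\dots\}$. For $\eta\in\mathbb{N}^L$ and $x\neq y$, $\eta^{xy}$ is obtained by moving one particle from $x$ to $y$: if $\eta_x>0$ then $\eta^{xy}_x=\eta_x-1$, $\eta^{xy}_y=\eta_y+1$, $\eta^{xy}_z=\eta_z$ for $z\ne x,y$; if $\eta_x=0$ then $\eta^{xy}=\eta$. Also $\eta^{xx}=\eta$. $\nabla_{xy}f(\eta)=f(\eta^{xy})-f(\eta)$. The measure is $\pi_N(\eta)=\frac1{Z_N}\prod_{x=1}^Lp_x(\eta_x)$ on $S_N$, where $p_x(0)=1$, $p_x(n)=\prod_{k=1}^n\frac1{c_x(k)}$ for $n\ge1$, and $Z_N$ is the normalization. $\pi[g]$ denotes expectation under $\pi$. $\mathcal{E}(f,g)=-\pi[f\mathcal{L}g]=\frac1{2L}\sum_{x,y}\pi[c_x(\eta_x)\nabla_{xy}f(\eta)\nabla_{xy}g(\eta)]$. $\mathrm{Ent}_\pi(f)=\pi[f\log f]-\pi[f]\log\pi[f]$. *)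

(* Defs.v *)
From HB Require Import structures.
From mathcomp Require Import all_boot all_order all_algebra.
From mathcomp Require Import reals exp.

Set Implicit Arguments.
Unset Strict Implicit.
Unset Printing Implicit Defensive.

Import Order.TTheory GRing.Theory Num.Theory.
Local Open Scope ring_scope.

Record config (L N : nat) := Config {
  occ :> {ffun 'I_L -> nat};
  _ : (\sum_(x < L) occ x == N)%N
}.

HB.instance Definition _ L N := [isSub for @occ L N].
HB.instance Definition _ L N := [Countable of config L N by <:].

Section ConfigFinite.
Variables L N : nat.

Lemma config_sum (eta : config L N) : (\sum_(x < L) eta x = N)%N.
Proof. exact/eqP/(valP eta). Qed.

Lemma config_le (eta : config L N) x : (eta x <= N)%N.
Proof.
have := leq_addr (\sum_(y < L | y != x) eta y) (eta x).
by rewrite -(bigD1 x (P := xpredT) (F := eta)) //= config_sum.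
Qed.

(* Occupation numbers are at most N, so S_N embeds into a finite type. *)
Definition config_code (eta : config L N) : {ffun 'I_L -> 'I_N.+1} :=
  [ffun x => inord (eta x)].

Definition config_decode (e : {ffun 'I_L -> 'I_N.+1}) : option (config L N) :=
  insub [ffun x => nat_of_ord (e x)].

Lemma config_codeK : pcancel config_code config_decode.
Proof.
move=> eta; rewrite /config_decode.
suff -> : [ffun x => nat_of_ord (config_code eta x)] = val eta by rewrite valK.
by apply/ffunP => x; rewrite !ffunE inordK // ltnS config_le.
Qed.

End ConfigFinite.

HB.instance Definition _ L N : isFinite (config L N) :=
  PCanIsFinite (@config_codeK L N).

Definition move_fun (L : nat) (eta : {ffun 'I_L -> nat}) (x y : 'I_L) :
    {ffun 'I_L -> nat} :=
  if (x == y) || (eta x == 0%N) then eta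
  else [ffun z => if z == x then (eta z).-1
                  else if z == y then (eta z).+1 else eta z].

Lemma move_fun_sum (L : nat) (eta : {ffun 'I_L -> nat}) (x y : 'I_L) :
  (\sum_(z < L) move_fun eta x y z = \sum_(z < L) eta z)%N.
Proof.
rewrite /move_fun; case: ifPn => //.
rewrite negb_or => /andP[xy ex]; have yx : y != x by rewrite eq_sym.
rewrite [LHS](bigD1 x) //= [X in (_ + X)%N = _](bigD1 y) //=.
rewrite [RHS](bigD1 x) //= [X in _ = (_ + X)%N](bigD1 y) //=.
rewrite !ffunE !eqxx (negPf yx).
rewrite (eq_bigr (fun z => eta z)); last first.
  by move=> z /andP[zx zy]; rewrite ffunE (negPf zx) (negPf zy).
by move: ex; case: (eta x) => // n _; rewrite addSn addnS addSn.
Qed.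

Lemma move_subproof (L N : nat) (eta : config L N) (x y : 'I_L) :
  (\sum_(z < L) move_fun eta x y z == N)%N.
Proof. by rewrite move_fun_sum config_sum. Qed.

Definition move (L N : nat) (eta : config L N) (x y : 'I_L) : config L N :=
  Config (move_subproof eta x y).

Section ZeroRange.
Variables (R : realType) (L N : nat) (c : 'I_L -> nat -> R).
Implicit Types f g : config L N -> R.

Definition grad (x y : 'I_L) f (eta : config L N) : R :=
  f (move eta x y) - f eta.

Definition gen f (eta : config L N) : R :=
  L%:R^-1 * \sum_(x < L) \sum_(y < L) c x (eta x) * grad x y f eta.

Definition pweight (x : 'I_L) (n : nat) : R :=
  \prod_(1 <= k < n.+1) (c x k)^-1.

Definition weight (eta : config L N) : R := \prod_(x < L) pweight x (eta x).

Definition partition_fun : R := \sum_(eta : config L N) weight eta.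

Definition zr_measure (eta : config L N) : R := partition_fun^-1 * weight eta.

Definition expect g : R := \sum_(eta : config L N) zr_measure eta * g eta.

Definition dirichlet f g : R := - expect (fun eta => f eta * gen g eta).

Definition entropy f : R :=
  expect (fun eta => f eta * ln (f eta)) - expect f * ln (expect f).

End ZeroRange.

(* Main.v *)
Require Import Defs.
From mathcomp Require Import all_boot all_order all_algebra.
From mathcomp Require Import boolp classical_sets functions topology normedtype.
From mathcomp Require Import derive realfun reals exp ring lra.

(** The weight of [eta] times the rate [c_x (eta x)] is the weight of the
configuration left when one particle is taken away from [x]. Hence a sum over
the [N]-particle configurations, weighted by the rate at which a particle leaves
[x], is a sum over a background [zeta] of [N - 1] particles to which one particle
is added at [x] ([sum_weight_addp]). Applied to the expectation of
[L f * (L (log f) + L f / f)] this brings out one moving particle. The second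
generator carries the rate [c_u ((zeta + x) u)], which is [c_u (zeta u)] plus, when
[u = x], the increment [c_x (zeta x + 1) - c_x (zeta x)]. So the expectation splits
into

- a sum over two distinct particles which move independently over a background
  of [N - 2] particles. For each square of positions [x, y] for the first one and
  [u, v] for the second one, the four values of [f] at the corners contribute
  [P * (t - 1 - ln t) + Q * (1 / t - 1 + ln t)] with [P, Q, t > 0], which is
  nonnegative ([two_particle_ge0]);

- a sum over a single particle moving over [zeta], where the generator is the
  difference with the plain average over the sites. There the increments are only
  known to lie in [[c, c + delta]], and what the fluctuation of the increments can
  cost is paid by the term [(L f)^2 / f] ([one_particle_ge]).

This gives the first inequality with the constant [c], hence with [c - delta] as
[E(f, log f) >= 0]. It is the statement that the entropy is convex along the heat
flow: if [f] evolves by [L], the entropy decays at rate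
[E(f, log f)] and [E(f, log f)] decays at a rate equal to the right-hand side. The
usual way to the second inequality is to integrate along the flow up to time
infinity. The proof below is instead variational and never runs the flow
([modified_log_sobolev]): for [k' < c - delta], the functional
[J = E(g, log g) - k' * Ent(g)] attains its minimum over a box
[m <= g <= M] with [m > 0], by compactness. The box is stable under small Euler
steps [g + h * L g], so at a minimiser the derivative of [J] in the direction [L g]
is nonnegative ([is_derive_defect]); by the first inequality that derivative is at
most [- (c - delta - k') * E(g, log g)]. So [E(g, log g) = 0], the minimiser is
constant since particles can be moved anywhere one by one, and [J] vanishes
there. Hence [J >= 0] on the box, and [k'] may tend to [c - delta]. *)

Import Order.TTheory GRing.Theory Num.Theory.
Import numFieldNormedType.Exports.
Local Open Scope ring_scope.

(** * Convexity inequalities for the logarithm *)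

Section Inequalities.
Context {R : realType}.

Lemma ln_le_subr1 (t : R) : 0 < t -> ln t <= t - 1.
Proof.
by move=> t0; rewrite -[t in ln t](subrKC 1) le_ln1Dx// ltrBrDl subrr.
Qed.

Lemma sub_mul_ln_ge0 (a b : R) : 0 < a -> 0 < b ->
  0 <= (a - b) * (ln a - ln b) ?= iff (a == b).
Proof.
move=> a0 b0; apply/leifP; case: eqVneq => [->|]; first by rewrite subrr mul0r.
rewrite neq_lt => /orP[ab|ba].
  by rewrite nmulr_rgt0 subr_lt0// ltr_ln.
by rewrite mulr_gt0// subr_gt0// ltr_ln.
Qed.

(** The values of a positive function at the corners of a square, [a] being opposite
to [d]. The sum vanishes exactly when [b * e = a * d], that is for product
functions: two independent particles do not interact. *)
Lemma square_term_ge0 (a b d e : R) : 0 < a -> 0 < b -> 0 < d -> 0 < e ->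
  0 <= (b - a) * (ln e - ln a + (e - a) / a)
     + (a - b) * (ln d - ln b + (d - b) / b)
     + ((d - e) * (ln a - ln e + (a - e) / e)
     + (e - d) * (ln b - ln d + (b - d) / d)).
Proof.
move=> a0 b0 d0 e0.
(* The sum depends on the logarithms only through that of the cross-ratio. *)
pose t := b * e / (a * d).
have t0 : 0 < t by rewrite divr_gt0 ?mulr_gt0.
have lnt : ln t = ln b + ln e - (ln a + ln d).
  by rewrite ln_div ?lnM ?posrE ?mulr_gt0.
have le1 : 0 <= t - 1 - ln t by rewrite subr_ge0 ln_le_subr1.
have le2 : 0 <= t^-1 - 1 + ln t.
  by rewrite -[ln t]opprK -lnV ?posrE// subr_ge0 ln_le_subr1 ?invr_gt0.
suff -> : (b - a) * (ln e - ln a + (e - a) / a)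
     + (a - b) * (ln d - ln b + (d - b) / b)
     + ((d - e) * (ln a - ln e + (a - e) / e)
     + (e - d) * (ln b - ln d + (b - d) / d))
     = (a + d) * (t - 1 - ln t) + (b + e) * (t^-1 - 1 + ln t).
  by rewrite addr_ge0// mulr_ge0// addr_ge0// ltW.
rewrite lnt /t; field.
by rewrite !gt_eqF.
Qed.

Lemma sum_sym_ge0 {I : finType} (T : I -> I -> R) :
  (forall x y, 0 <= T x y + T y x) -> 0 <= \sum_x \sum_y T x y.
Proof.
move=> T0; rewrite -(pmulrn_lge0 _ (isT : 0 < 2)%N) mulr2n.
rewrite [X in _ + X]exchange_big -big_split sumr_ge0 //= => x _.
rewrite -big_split sumr_ge0 //= => y _; exact: T0.
Qed.

(** Reversing each of the two moves [x -> y] and [u -> v] permutes the corners of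
the square; the sum over these four orientations is nonnegative although a single
one may not be. *)
Lemma two_particle_ge0 (I : finType) (F : I -> I -> R) :
  (forall x u, 0 < F x u) ->
  0 <= \sum_x \sum_y \sum_u \sum_v (F y u - F x u) *
         (ln (F x v) - ln (F x u) + (F x v - F x u) / F x u).
Proof.
move=> F0; pose t x y u v : R :=
  (F y u - F x u) * (ln (F x v) - ln (F x u) + (F x v - F x u) / F x u).
apply: (sum_sym_ge0 (fun x y => \sum_u \sum_v t x y u v)) => x y.
rewrite -big_split/=; under eq_bigr do rewrite -big_split/=.
apply: (sum_sym_ge0 (fun u v => t x y u v + t y x u v)) => u v.
exact: square_term_ge0.
Qed.

(** With [n = #|I|], [m] the mean of [F] and [mu] the mean of [ln F], the right-hand
side is [n ^ 2] times the sum of the [a x * g x], where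
[g x = (m - F x) * (mu - ln (F x)) + (m - F x) ^ 2 / F x]. Up to the factor
[n ^ 2], replacing [a x] by [k] produces the left-hand side plus [k] times the sum
of the [(m - F x) ^ 2 / F x]. As [g x >= m * nu] with [nu = mu - ln m <= 0], the
excess [a x - k <= d] costs at most [d * n * m * (- nu)], and that sum of squares is
at least [n * m * (- nu)], so that [d <= k] suffices. *)
Lemma one_particle_ge (I : finType) (F a : I -> R) (k d : R) :
  (0 < #|I|)%N -> (forall x, 0 < F x) -> 0 <= d -> d <= k ->
  (forall x, k <= a x <= k + d) ->
  k * #|I|%:R * (\sum_x F x * \sum_y (ln (F x) - ln (F y))) <=
  \sum_x a x * ((\sum_y (F y - F x)) *
     (\sum_y (ln (F y) - ln (F x) + (F y - F x) / F x))).
Proof.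
move=> I0 F0 d0 dk ak; set n : R := #|I|%:R.
have n0 : 0 < n by rewrite ltr0n.
have sumc (b : R) : \sum_(x : I) b = n * b.
  by rewrite sumr_const -mulr_natl.
pose m := (\sum_x F x) / n; pose mu := (\sum_x ln (F x)) / n.
have nm : \sum_x F x = n * m by rewrite /m mulrC divfK ?gt_eqF.
have nmu : \sum_x ln (F x) = n * mu by rewrite /mu mulrC divfK ?gt_eqF.
have m0 : 0 < m.
  rewrite divr_gt0//; case/card_gt0P: I0 => x _; rewrite (bigD1 x)//=.
  by rewrite ltr_pwDl// sumr_ge0// => y _; rewrite ltW.
(* The Jensen gap of the logarithm, which measures how far F is from constant. *)
pose nu := mu - ln m.
have nu0 : nu <= 0.
  rewrite -(pmulr_rle0 _ n0) /nu mulrBr -nmu -(sumc (ln m)) -sumrB.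
  rewrite [leRHS](_ : 0 = \sum_x (F x / m - 1)); last first.
    by rewrite sumrB sumc -mulr_suml nm mulfK ?gt_eqF// mulr1 subrr.
  apply: ler_sum => x _.
  by rewrite -ln_div ?posrE// ln_le_subr1// divr_gt0.
pose q x := (m - F x) ^+ 2 / F x.
(* The chi-square type term controls the Jensen gap, as ln t <= t - 1. *)
have sumq : n * (m * - nu) <= \sum_x q x.
  have -> : \sum_x q x = \sum_x m * (m / F x - 1).
    apply/eqP; rewrite -subr_eq0 -sumrB.
    under eq_bigr => x _.
      rewrite (_ : _ - _ = F x - m); last by rewrite /q; field; rewrite gt_eqF.
      over.
    by rewrite sumrB sumc nm subrr.
  rewrite -mulr_sumr mulrCA ler_pM2l// /nu opprB mulrBr -nmu -(sumc (ln m)).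
  rewrite -sumrB; apply: ler_sum => x _.
  by rewrite -ln_div ?posrE// ln_le_subr1// divr_gt0.
pose g x := (m - F x) * (mu - ln (F x)) + q x.
(* The only part of g x that may be negative is (m - F x) * nu, and F > 0. *)
have g_ge x : m * nu <= g x.
  have -> : g x = m * nu + F x * (- nu)
      + (m - F x) * (ln m - ln (F x)) + q x.
    by rewrite /g /nu; ring.
  have h1 : 0 <= F x * - nu by rewrite mulr_ge0 ?oppr_ge0// ltW.
  have h2 : 0 <= q x by rewrite divr_ge0 ?sqr_ge0// ltW.
  have h3 : 0 <= (m - F x) * (ln m - ln (F x)).
    have [mF|Fm] := leP m (F x).
      by rewrite mulr_le0// subr_le0// ler_ln ?posrE.
    by rewrite mulr_ge0// subr_ge0 ?ler_ln ?posrE// ltW.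
  by lra.
have rhsE x : (\sum_y (F y - F x)) *
     (\sum_y (ln (F y) - ln (F x) + (F y - F x) / F x)) = n ^+ 2 * g x.
  rewrite [X in _ * X]big_split/= -mulr_suml !sumrB !sumc nm nmu /g /q.
  by field; rewrite gt_eqF.
have lhsE : \sum_x F x * (\sum_y (ln (F x) - ln (F y)))
   = n * \sum_x (m - F x) * (mu - ln (F x)).
  have -> : \sum_x (m - F x) * (mu - ln (F x))
      = \sum_x F x * (ln (F x) - mu) + m * \sum_x (mu - ln (F x)).
    by rewrite mulr_sumr -big_split; apply: eq_bigr => x _ /=; ring.
  rewrite [\sum_x (mu - _)]sumrB sumc nmu subrr mulr0 addr0 mulr_sumr.
  by apply: eq_bigr => x _; rewrite sumrB sumc nmu; ring.
rewrite [leRHS](eq_bigr (fun x => n ^+ 2 * (a x * g x))); last first.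
  by move=> x _; rewrite rhsE mulrCA.
rewrite -mulr_sumr lhsE [leLHS](_ : _ =
  n ^+ 2 * (k * \sum_x (m - F x) * (mu - ln (F x)))); last by ring.
rewrite ler_pM2l ?exprn_gt0//.
have step : k * (\sum_x g x) + n * (d * (m * nu)) <= \sum_x a x * g x.
  rewrite -sumc mulr_sumr -big_split; apply: ler_sum => x _ /=.
  have /andP[ax1 ax2] := ak x.
  have -> : a x * g x = k * g x + (a x - k) * (g x - m * nu)
      + (a x - k) * (m * nu) by ring.
  have h1 : 0 <= (a x - k) * (g x - m * nu).
    by rewrite mulr_ge0 ?subr_ge0.
  have h2 : d * (m * nu) <= (a x - k) * (m * nu).
    by rewrite ler_wnM2r ?lerBlDl// mulr_ge0_le0// ltW.
  by lra.
apply: le_trans step; rewrite /g big_split/= mulrDr -addrA lerDl.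
have h1 : 0 <= (k - d) * (n * (m * - nu)).
  rewrite mulr_ge0 ?subr_ge0//; apply: mulr_ge0; first exact: ltW.
  by apply: mulr_ge0; [exact: ltW | rewrite oppr_ge0].
have h2 : 0 <= k * (\sum_x q x - n * (m * - nu)).
  by rewrite mulr_ge0 ?subr_ge0// (le_trans d0).
by lra.
Qed.

End Inequalities.

(** * One-sided minima and derivatives *)

Section Calculus.
Context {R : realType}.
Local Open Scope classical_set_scope.
Local Open Scope ring_scope.

Lemma derive_right_min (phi : R -> R) (l h0 : R) : 0 < h0 ->
  (forall h, 0 <= h <= h0 -> phi 0 <= phi h) -> is_derive (0 : R) 1 phi l ->
  0 <= l.
Proof.
move=> h00 min [dphi <-]; rewrite /derive.
rewrite (cvg_at_rightE (fun h => h^-1 *: ((phi \o shift 0) (h *: 1) - phi 0)))//.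
apply: limr_ge.
  rewrite -(cvg_at_rightE (fun h => h^-1 *: ((phi \o shift 0) (h *: 1) - phi 0)))//.
  apply: cvg_trans dphi; apply: cvg_app => B [e e0 eB].
  by exists e => // h he h_gt0; apply: eB => //; exact: lt0r_neq0.
near=> h; apply: mulr_ge0; first by rewrite invr_ge0; near: h; exact: nbhs_right_ge.
rewrite subr_ge0 /= addr0 [_ *: _]mulr1; apply: min; apply/andP; split.
  by near: h; exact: nbhs_right_ge.
by near: h; exact: nbhs_right_le.
Unshelve. all: by end_near. Qed.

Lemma is_derive_linear_ln (a b u v : R) : 0 < u ->
  is_derive (0 : R) 1 (fun h => (a + h * b) * ln (u + h * v))
    (b * ln u + a * (v / u)).
Proof.
move=> u0.
have aff (s t : R) : is_derive (0 : R) 1 (fun h => s + h * t) t.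
  have -> : (fun h => s + h * t) = cst s + t *: id.
    by apply/funext => h; rewrite /= mulrC.
  by apply: is_derive_eq; rewrite add0r [_ *: _]mulr1.
have dln : is_derive (u + 0 * v) 1 (@ln R) u^-1.
  by rewrite mul0r addr0; exact: is_derive1_ln.
have dc : is_derive (0 : R) 1 (@ln R \o (fun h => u + h * v)) (u^-1 * v).
  exact: is_derive1_comp.
apply: (is_derive_eq (is_deriveM (aff a b) dc)).
by rewrite /= !mul0r !addr0 /GRing.scale/=; ring.
Qed.

Lemma is_derive_big {I : Type} (r : seq I) (x : R) (F : I -> R -> R) (dF : I -> R) :
  (forall i, is_derive x 1 (F i) (dF i)) ->
  is_derive x 1 (fun h => \sum_(i <- r) F i h) (\sum_(i <- r) dF i).
Proof.
move=> dFP; elim: r => [|i r IH].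
  rewrite big_nil (_ : (fun _ => _) = cst 0); first exact: is_derive_cst.
  by apply/funext => h; rewrite big_nil.
rewrite big_cons (_ : (fun _ => _) = F i + (fun h => \sum_(j <- r) F j h)).
  exact: is_deriveD.
by apply/funext => h; rewrite big_cons.
Qed.

End Calculus.

(** * From entropy convexity to the modified logarithmic Sobolev inequality *)

Section MarkovChain.
Local Open Scope classical_set_scope.
Local Open Scope ring_scope.
Context {R : realType} {T : finType} (p : T -> R) (Q : T -> T -> R).
Hypotheses (p_gt0 : forall x, 0 < p x) (p_sum : \sum_x p x = 1).
Hypotheses (Q_ge0 : forall x y, 0 <= Q x y)
  (Q_rev : forall x y, p x * Q x y = p y * Q y x).
Implicit Types f g : T -> R.

Definition mean g : R := \sum_x p x * g x.

Definition markov_gen g x : R := \sum_y Q x y * (g y - g x).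

Local Notation A := markov_gen.

(** The Dirichlet form [E(g, log g)]: minus the derivative of the entropy along the
heat flow. *)
Definition entropy_production g : R :=
  - mean (fun x => g x * A (fun y => ln (g y)) x).

Definition relative_entropy g : R :=
  mean (fun x => g x * ln (g x)) - mean g * ln (mean g).

(** Minus the derivative of [entropy_production] along the heat flow, see
[is_derive_defect]. *)
Definition production_decay g : R :=
  mean (fun x => A g x * A (fun y => ln (g y)) x)
  + mean (fun x => A g x ^+ 2 / g x).

Lemma mean_ge (m : R) g : (forall x, m <= g x) -> m <= mean g.
Proof.
move=> mg; rewrite -[m]mul1r -p_sum mulr_suml ler_sum// => x _.
by rewrite ler_wpM2l// ltW.
Qed.

Lemma markov_gen_sym f g :
  mean (fun x => g x * A f x) = mean (fun x => f x * A g x).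
Proof.
have E (u v : T -> R) : mean (fun x => u x * A v x) =
    \sum_x \sum_y p x * Q x y * (u x * v y)
    - \sum_x \sum_y p x * Q x y * (u x * v x).
  rewrite -sumrB; apply: eq_bigr => x _; rewrite -sumrB mulrA mulr_sumr.
  by apply: eq_bigr => y _; ring.
rewrite !E; congr (_ - _); last first.
  by apply: eq_bigr => x _; apply: eq_bigr => y _; rewrite [f x * _]mulrC.
rewrite exchange_big; apply: eq_bigr => x _; apply: eq_bigr => y _.
by rewrite -Q_rev [f x * _]mulrC.
Qed.

Lemma mean_markov_gen g : mean (A g) = 0.
Proof.
have := markov_gen_sym g (fun=> 1); rewrite /mean.
under eq_bigr do rewrite mul1r.
move=> ->; rewrite big1// => x _; rewrite [A _ _]big1 ?mulr0// => y _.
by rewrite subrr mulr0.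
Qed.

Lemma entropy_productionE g : entropy_production g *+ 2 =
  \sum_x \sum_y p x * Q x y * ((g x - g y) * (ln (g x) - ln (g y))).
Proof.
pose t x y := p x * Q x y * (g x * (ln (g x) - ln (g y))).
have -> : entropy_production g = \sum_x \sum_y t x y.
  rewrite /entropy_production /mean -sumrN; apply: eq_bigr => x _.
  rewrite mulrA mulr_sumr -sumrN.
  by apply: eq_bigr => y _; rewrite /t; ring.
rewrite mulr2n [X in _ + X]exchange_big -big_split; apply: eq_bigr => x _.
rewrite -big_split; apply: eq_bigr => y _ /=.
by rewrite /t -Q_rev; ring.
Qed.

Lemma entropy_production_ge0 g : (forall x, 0 < g x) ->
  0 <= entropy_production g.
Proof.
move=> g0; rewrite -(pmulrn_lge0 _ (isT : 0 < 2)%N) entropy_productionE.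
apply: sumr_ge0 => x _; apply: sumr_ge0 => y _; apply: mulr_ge0.
  by rewrite mulr_ge0// ltW.
by rewrite sub_mul_ln_ge0.
Qed.

Lemma entropy_production_eq0 g : (forall x, 0 < g x) ->
  entropy_production g = 0 -> forall x y, 0 < Q x y -> g x = g y.
Proof.
move=> g0 E0 x y Qxy; have := entropy_productionE g; rewrite E0 mul0rn.
have t0 u v : 0 <= p u * Q u v * ((g u - g v) * (ln (g u) - ln (g v))).
  by rewrite mulr_ge0 ?sub_mul_ln_ge0// mulr_ge0// ltW.
move/esym/eqP; rewrite psumr_eq0 => [/allP/(_ x)|u _]; last exact: sumr_ge0.
rewrite mem_index_enum => /(_ isT)/=; rewrite psumr_eq0// => /allP/(_ y).
rewrite mem_index_enum => /(_ isT)/=.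
rewrite mulf_eq0 gt_eqF ?mulr_gt0//= => t.
by apply/eqP; rewrite -(sub_mul_ln_ge0 _ _ (g0 x) (g0 y)) eq_sym.
Qed.

(** For [h] times the total jump rate at most [1], the Euler step replaces [g x] by a
convex combination of values of [g]. Applied to [g] and [- g], this keeps every
interval [[m, M]] containing the values of [g] invariant. *)
Lemma euler_step_ge : exists2 h0 : R, 0 < h0 &
  forall h, 0 <= h <= h0 -> forall g m, (forall x, m <= g x) ->
  forall x, m <= g x + h * A g x.
Proof.
pose q := \sum_x \sum_y Q x y.
have q0 : 0 <= q by apply: sumr_ge0 => x _; exact: sumr_ge0.
exists (1 + q)^-1; first by rewrite invr_gt0 ltr_pwDl.
move=> h /andP[h0 hq] g m mg x; rewrite -subr_ge0.
have -> : g x + h * A g x - m = (1 - h * \sum_y Q x y) * (g x - m)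
    + h * \sum_y Q x y * (g y - m).
  have -> : A g x = \sum_y Q x y * (g y - m) - (\sum_y Q x y) * (g x - m).
    by rewrite mulr_suml -sumrB; apply: eq_bigr => y _; ring.
  by ring.
apply: addr_ge0; last first.
  by rewrite mulr_ge0// sumr_ge0// => y _; rewrite mulr_ge0// subr_ge0.
rewrite mulr_ge0 ?subr_ge0//.
have qx : \sum_y Q x y <= 1 + q.
  rewrite ler_wpDl// /q [leRHS](bigD1 x)//= lerDl.
  by apply: sumr_ge0 => z _; exact: sumr_ge0.
apply: (@le_trans _ _ (h * (1 + q))); first by rewrite ler_wpM2l.
by rewrite -ler_pdivlMr ?mul1r// ltr_pwDl.
Qed.

(** The modified logarithmic Sobolev inequality with constant [k] says that [defect k]
is nonnegative. *)
Definition defect k g : R := entropy_production g - k * relative_entropy g.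

(** Symmetry of the generator moves it away from the logarithm, so that along
[g + h * L g] each term is an affine function of [h] times the logarithm of
another one. *)
Lemma defectE k g : defect k g =
  k * (mean g * ln (mean g))
  - \sum_x p x * ((A g x + k * g x) * ln (g x)).
Proof.
rewrite /defect /entropy_production markov_gen_sym /relative_entropy.
rewrite mulrBr opprB addrCA; congr (_ + _).
rewrite mulr_sumr -opprD -big_split; congr (- _); apply: eq_bigr => x _ /=.
by ring.
Qed.

Lemma mean_markov_step g h : mean (fun x => g x + h * A g x) = mean g.
Proof.
have -> : mean (fun x => g x + h * A g x) = mean g + h * mean (A g).
  by rewrite /mean mulr_sumr -big_split; apply: eq_bigr => x _ /=; ring.
by rewrite mean_markov_gen mulr0 addr0.
Qed.

Lemma markov_gen_step g h x :
  A (fun y => g y + h * A g y) x = A g x + h * A (A g) x.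
Proof.
by rewrite [X in _ = X + _]/A [X in _ = _ + _ * X]/A mulr_sumr -big_split;
  apply: eq_bigr => y _ /=; ring.
Qed.

(** The entropy has derivative [mean (L g * ln g)], which is
[- entropy_production g]: differentiating the logarithm contributes
[mean (L g) = 0]. In the entropy production, differentiating the logarithm
contributes the term in [(L g) ^ 2 / g]. *)
Lemma is_derive_defect k g : (forall x, 0 < g x) ->
  is_derive (0 : R) 1 (fun h => defect k (fun x => g x + h * A g x))
    (k * entropy_production g - production_decay g).
Proof.
move=> g0.
pose b x := A (A g) x + k * A g x; pose a x := A g x + k * g x.
pose phi x := fun h : R => (a x + h * b x) * ln (g x + h * A g x).
have -> : (fun h => defect k (fun x => g x + h * A g x)) =
    cst (k * (mean g * ln (mean g))) - (fun h => \sum_x p x * phi x h).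
  apply/funext => h; rewrite defectE mean_markov_step; congr (_ - _).
  apply: eq_bigr => x _; congr (_ * _); rewrite markov_gen_step /phi /a /b.
  by congr (_ * _); ring.
pose dphi x := b x * ln (g x) + a x * (A g x / g x).
have dphiP x : is_derive (0 : R) 1 (fun h => p x * phi x h) (p x * dphi x).
  by apply: (is_deriveZ (p x)); exact: is_derive_linear_ln.
have dsum := is_derive_big (index_enum T) (0 : R) _ _ dphiP.
apply: (is_derive_eq (is_deriveB (is_derive_cst _ _ _) dsum)).
rewrite sub0r /entropy_production markov_gen_sym /production_decay.
have <- : mean (fun x => A (A g) x * ln (g x)) =
    mean (fun x => A g x * A (fun y => ln (g y)) x).
  by rewrite markov_gen_sym /mean; apply: eq_bigr => x _; rewrite [ln _ * _]mulrC.
have := mean_markov_gen g => m0.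
rewrite [X in - X](_ : _ = mean (fun x => A (A g) x * ln (g x))
   + k * mean (fun x => ln (g x) * A g x)
   + mean (fun x => A g x ^+ 2 / g x) + k * mean (A g)); last first.
  rewrite /mean !mulr_sumr -!big_split; apply: eq_bigr => x _ /=.
  by rewrite /dphi /a /b /GRing.scale /=; field; rewrite gt_eqF.
by rewrite m0; ring.
Qed.

Lemma cvg_defect {U : Type} (F : set_system U) {FF : Filter F} k m
    (G : U -> T -> R) g : 0 < m -> (forall x, m <= g x) ->
  (forall x, G u x @[u --> F] --> g x) -> defect k (G u) @[u --> F] --> defect k g.
Proof.
move=> m0 mg cG.
have csum (H : T -> U -> R) (l : T -> R) : (forall x, H x u @[u --> F] --> l x) ->
    \sum_x H x u @[u --> F] --> \sum_x l x.
  by move=> cH; apply: cvg_big => [|x _]; [exact: (@add_continuous R^o)|exact: cH].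
have cA x : A (G u) x @[u --> F] --> A g x.
  by apply: csum => y; apply: cvgM; [exact: cvg_cst | exact: cvgB].
have cmean : mean (G u) @[u --> F] --> mean g.
  by apply: csum => x; apply: cvgM; [exact: cvg_cst | exact: cG].
have cln (H : U -> R) (l : R) : H u @[u --> F] --> l -> m <= l ->
    ln (H u) @[u --> F] --> ln l.
  move=> cH ml; apply: (cvg_comp _ _ cH); apply: continuous_ln.
  exact: lt_le_trans ml.
under [X in X @ _]funext do rewrite defectE.
rewrite defectE; apply: cvgB.
  apply: cvgM; [exact: cvg_cst | apply: cvgM => //].
  by apply: cln => //; exact: mean_ge.
apply: csum => x; apply: cvgM; first exact: cvg_cst.
apply: cvgM; last exact: cln.
by apply: cvgD => //; apply: cvgM; [exact: cvg_cst | exact: cG].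
Qed.

Lemma defect_min k m M f : 0 < m -> (forall x, m <= f x <= M) ->
  exists2 g : T -> R, forall x, m <= g x <= M &
    forall g', (forall x, m <= g' x <= M) -> defect k g <= defect k g'.
Proof.
move=> m0 mfM.
(* Functions on T are encoded as row vectors, for which boxes are compact. *)
pose ev (u : 'rV[R]_#|T|) x := u ord0 (enum_rank x).
pose vec g : 'rV[R]_#|T| := \row_i g (enum_val i).
have vecK g : ev (vec g) = g by apply/funext => x; rewrite /ev mxE enum_rankK.
pose K := [set v : 'rV[R]_#|T| | forall i, `[m, M]%classic (v ord0 i)]%classic.
have vecP g : (forall x, m <= g x <= M) -> K (vec g).
  by move=> gb i; rewrite /= in_itv/= mxE.
have cK : compact K.
  by apply: (@rV_compact R _ (fun=> `[m, M]%classic)) => _; exact: segment_compact.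
have [v vK vmin] : exists2 v, v \in K & forall t, t \in K ->
    defect k (ev v) <= defect k (ev t).
  apply: (compact_EVT_min (f := fun u => defect k (ev u))) cK _.
    by exists (vec f); exact: vecP.
  apply: continuous_in_subspaceT => u; rewrite inE => uK.
  apply: (@cvg_defect _ (nbhs u) _ k m) => // x; last exact: coord_continuous.
  by have := uK (enum_rank x); rewrite /= in_itv/= => /andP[].
exists (ev v) => [x|g gb].
  by move: vK; rewrite inE => /(_ (enum_rank x)); rewrite /= in_itv.
by rewrite -[g in leRHS]vecK; apply: vmin; rewrite inE; exact: vecP.
Qed.

(** The Bakry-Emery criterion, with the heat flow replaced by its velocity at a
minimiser of the defect: there the hypothesis forces the entropy production to
vanish, irreducibility makes the minimiser constant, and the defect of a constant
is zero. *)
Lemma modified_log_sobolev (k : R) f :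
  (forall g, (forall x y, 0 < Q x y -> g x = g y) -> forall x y, g x = g y) ->
  (forall g, (forall x, 0 < g x) ->
     k * entropy_production g <= production_decay g) ->
  (forall x, 0 < f x) ->
  k * relative_entropy f <= entropy_production f.
Proof.
move=> irr decay f0.
(* A constant k' < k makes the inequality at the minimiser strict. *)
suff lt_k k' : k' < k -> 0 <= defect k' f.
  apply/ler_addgt0Pr => e e0.
  pose d := e / (1 + `|relative_entropy f|).
  have nE : 0 < 1 + `|relative_entropy f| by rewrite ltr_pwDl.
  have d0 : 0 < d by rewrite divr_gt0.
  have := lt_k (k - d); rewrite ltrBlDr ltrDl => /(_ d0).
  rewrite /defect subr_ge0 mulrBl lerBlDr => /le_trans; apply.
  rewrite lerD2l /d mulrAC ler_pdivrMr// ler_wpM2l ?ltW//.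
  by apply: (le_lt_trans (ler_norm _)); rewrite ltrDr.
move=> k'k.
(* A positive lower bound of f that needs no point of T to be chosen. *)
pose s := \sum_x (f x)^-1; pose m := (1 + s)^-1; pose M := \sum_x f x.
have s0 : 0 <= s by apply: sumr_ge0 => x _; rewrite invr_ge0 ltW.
have m0 : 0 < m by rewrite invr_gt0 ltr_pwDl.
have mfM x : m <= f x <= M.
  apply/andP; split; last first.
    by rewrite /M (bigD1 x)//= lerDl sumr_ge0// => y _; exact: ltW.
  rewrite -[f x]invrK lef_pV2 ?posrE ?invr_gt0 ?ltr_pwDl//.
  rewrite ler_wpDl// /s [leRHS](bigD1 x)//= lerDl.
  by apply: sumr_ge0 => y _; rewrite invr_ge0 ltW.
have [g gb gmin] := defect_min k' m M f m0 mfM.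
have g0 x : 0 < g x by apply: lt_le_trans m0 _; have /andP[] := gb x.
apply: le_trans (gmin _ mfM).
have [h0 h0_gt0 step] := euler_step_ge.
(* The Euler step stays in the box, hence does not decrease the defect; the upper
   bound M of g is handled as the lower bound - M of - g. *)
have dmin : 0 <= k' * entropy_production g - production_decay g.
  apply: derive_right_min h0_gt0 _ (is_derive_defect k' g g0) => h hh.
  rewrite [X in defect k' X <= _](_ : _ = g); last first.
    by apply/funext => x; rewrite mul0r addr0.
  apply: gmin => x; rewrite step//=; last by move=> y; have /andP[] := gb y.
  have := step h hh (fun y => - g y) (- M) _ x.
  have -> : A (fun y => - g y) x = - A g x.
    by rewrite /A -sumrN; apply: eq_bigr => y _; ring.
  rewrite mulrN -opprD lerN2; apply => y.
  by rewrite lerN2; have /andP[] := gb y.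
have E0 : entropy_production g = 0.
  apply/eqP; rewrite eq_le entropy_production_ge0// andbT.
  rewrite -(pmulr_rle0 _ (_ : 0 < k - k')) ?subr_gt0// mulrBl subr_le0.
  by rewrite (le_trans (decay g g0))// -subr_ge0.
have gcst := irr g (entropy_production_eq0 g g0 E0).
have mg x : mean g = g x.
  rewrite -[g x]mul1r -p_sum mulr_suml /mean.
  by apply: eq_bigr => y _; rewrite (gcst y x).
rewrite /defect E0 /relative_entropy [mean (fun _ => _)](_ : _ = mean g * ln (mean g)).
  by rewrite subrr mulr0 subrr.
rewrite [X in X * _]/mean mulr_suml; apply: eq_bigr => x _.
by rewrite -mulrA -!mg.
Qed.

End MarkovChain.

(** * Adding a particle to a configuration *)

Section Particles.
Context {L : nat}.

Definition addp_fun (zeta : {ffun 'I_L -> nat}) (x : 'I_L) : {ffun 'I_L -> nat} :=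
  [ffun z => (zeta z + (z == x))%N].

Lemma sum_delta (x : 'I_L) : (\sum_(z < L) (z == x) = 1)%N.
Proof. by rewrite (bigD1 x)//= eqxx big1// => z /negbTE->. Qed.

Lemma addp_subproof {M} (zeta : config L M) x :
  (\sum_(z < L) addp_fun zeta x z == M.+1)%N.
Proof.
under eq_bigr do rewrite ffunE.
by rewrite big_split/= config_sum sum_delta addn1.
Qed.

Definition addp {M} (zeta : config L M) x : config L M.+1 :=
  Config (addp_subproof zeta x).

Lemma addpE {M} (zeta : config L M) x z : addp zeta x z = (zeta z + (z == x))%N.
Proof. by rewrite ffunE. Qed.

Lemma addpC {M} (zeta : config L M) x y :
  addp (addp zeta x) y = addp (addp zeta y) x.
Proof. by apply/val_inj/ffunP => z; rewrite !ffunE addnAC. Qed.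

(** The source of all reindexings below: a jump from [x] to [y] starts and ends over
the same background. *)
Lemma move_addp {M} (zeta : config L M) x y :
  move (addp zeta x) x y = addp zeta y.
Proof.
apply/val_inj/ffunP => z; rewrite /= /move_fun.
rewrite [in _ == 0%N]ffunE eqxx addn1 orbF.
case: eqVneq => [->//|xy]; rewrite !ffunE.
case: (eqVneq z x) => [->|zx]; first by rewrite addn1 (negbTE xy) addn0.
by case: (z == y); rewrite ?addn0 ?addn1.
Qed.

Lemma config_addpP {M} (eta : config L M.+1) x :
  eta x != 0%N -> exists zeta, addp zeta x = eta.
Proof.
move=> ex; pose e : {ffun 'I_L -> nat} := [ffun z => eta z - (z == x)]%N.
have eE : addp_fun e x = occ eta.
  apply/ffunP => z; rewrite !ffunE subnK//.
  by case: eqVneq => // ->; rewrite lt0n.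
have eM : (\sum_(z < L) e z == M)%N.
  have := config_sum eta; rewrite -eE => /eqP.
  under eq_bigr do rewrite ffunE.
  by rewrite big_split/= sum_delta addn1 eqSS.
by exists (@Config L M e eM); apply/val_inj.
Qed.

Lemma addp_inj {M} x (z1 z2 : config L M) : addp z1 x = addp z2 x -> z1 = z2.
Proof.
move=> /(congr1 (fun e : config L M.+1 => occ e)) /ffunP e.
by apply/val_inj/ffunP => z; have := e z; rewrite !ffunE => /addIn.
Qed.

Lemma card_config_gt0 N : (0 < L)%N -> (0 < #|{: config L N}|)%N.
Proof.
move=> L0; apply/card_gt0P; elim: N => [|N [zeta _]]; last first.
  by exists (addp zeta (Ordinal L0)).
have e0 : (\sum_(x < L) [ffun=> 0%N : nat] x == 0)%N.
  by rewrite big1// => x _; rewrite ffunE.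
by exists (Config e0).
Qed.

(** Irreducibility of the particle system. *)
Lemma config_move_const {T : Type} {N} (f : config L N -> T) :
  (0 < L)%N ->
  (forall (eta : config L N) x y, eta x != 0%N -> f eta = f (move eta x y)) ->
  forall eta1 eta2, f eta1 = f eta2.
Proof.
move=> L0; elim: N f => [|N IH] f fmove eta1 eta2.
  congr f; apply/val_inj/ffunP => x.
  by apply/eqP; rewrite -[_ == _]/(eta1 x == eta2 x) eqn_leq;
    move: (config_le eta1 x) (config_le eta2 x); rewrite !leqn0 => /eqP-> /eqP->.
have [[x e1] [y e2]] : (exists x, eta1 x != 0%N) /\ (exists y, eta2 y != 0%N).
  have H (eta : config L N.+1) : exists x, eta x != 0%N.
    apply/existsP; apply: contraT => /existsPn e0.
    have := config_sum eta; rewrite big1// => x _.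
    by apply/eqP; have := e0 x; rewrite negbK.
  by [].
have [z1 <-] := config_addpP eta1 x e1.
have [z2 <-] := config_addpP eta2 y e2.
have addxy z : f (addp z x) = f (addp z y).
  by rewrite (fmove _ x y) ?move_addp// addpE eqxx addn1.
(* Move one particle of each configuration to y and forget it: one is left
   with configurations of N particles. *)
rewrite addxy; apply: (IH (fun z => f (addp z y))) => z u v zu.
have [M NM] : exists M, N = M.+1.
  exists N.-1; rewrite prednK// lt0n; apply: contra zu => /eqP N0.
  by rewrite -leqn0 -[X in (_ <= X)%N]N0 config_le.
move: z zu {IH z1 z2 e1 e2 addxy}; subst N => z zu.
have [w <-] := config_addpP z u zu.
rewrite move_addp addpC [in RHS]addpC -(move_addp (addp w y) u v); apply: fmove.
by rewrite addpE eqxx addn1.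
Qed.

End Particles.

(** * Convexity of the entropy for the zero-range process *)

Section ZeroRange.
Context {R : realType} {L : nat} (rate : 'I_L -> nat -> R).
Hypotheses (rate0 : forall x, rate x 0%N = 0)
  (rate_gt0 : forall x n, (0 < n)%N -> 0 < rate x n).
Local Notation w := (weight rate).

Lemma rate_config0 (eta : config L 0) x : rate x (eta x) = 0.
Proof. by have := config_le eta x; rewrite leqn0 => /eqP->; rewrite rate0. Qed.

Lemma rate_nonneg x n : 0 <= rate x n.
Proof. by case: n => [|n]; rewrite ?rate0// ltW ?rate_gt0. Qed.

Lemma weight_gt0 {N} (eta : config L N) : 0 < w eta.
Proof.
apply: prodr_gt0 => x _; rewrite /pweight big_nat_cond.
by apply: prodr_gt0 => k /andP[/andP[k0 _] _]; rewrite invr_gt0 rate_gt0.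
Qed.

Lemma partition_fun_gt0 N : (0 < L)%N -> 0 < partition_fun N rate :> R.
Proof.
move=> /(card_config_gt0 N)/card_gt0P[eta _].
rewrite /partition_fun (bigD1 eta)//= ltr_pwDl ?weight_gt0//.
by rewrite sumr_ge0// => s _; rewrite ltW ?weight_gt0.
Qed.

Lemma zr_measure_gt0 {N} (eta : config L N) : (0 < L)%N -> 0 < zr_measure rate eta.
Proof. by move=> L0; rewrite mulr_gt0 ?invr_gt0 ?partition_fun_gt0 ?weight_gt0. Qed.

Lemma sum_zr_measure N : (0 < L)%N -> \sum_(eta : config L N) zr_measure rate eta = 1.
Proof. by move=> L0; rewrite -mulr_sumr mulVf// gt_eqF ?partition_fun_gt0. Qed.

Lemma weight_addp {M} (zeta : config L M) x :
  w (addp zeta x) * rate x (zeta x).+1 = w zeta.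
Proof.
rewrite /weight (bigD1 x)//= [in RHS](bigD1 x)//= addpE eqxx addn1.
rewrite mulrAC /pweight big_nat_recr//= mulfVK ?gt_eqF ?rate_gt0//.
by congr (_ * _); apply: eq_bigr => z /negbTE zx; rewrite addpE zx addn0.
Qed.

(** Configurations with no particle at [x] do not contribute, and the others are
[zeta] plus a particle at [x] for a unique [zeta]. *)
Lemma sum_weight_addp {M} x (G : config L M.+1 -> R) :
  \sum_eta w eta * (rate x (eta x) * G eta)
  = \sum_zeta w zeta * G (addp zeta x).
Proof.
rewrite (bigID (fun eta : config L M.+1 => eta x == 0%N))/= big1; last first.
  by move=> eta /eqP->; rewrite rate0 mul0r mulr0.
rewrite add0r (reindex_omap (fun zeta => addp zeta x)
  (fun eta => [pick zeta | addp zeta x == eta])); last first.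
  move=> eta /config_addpP[zeta <-].
  case: pickP => [z /eqP zE|]; first by rewrite /= zE.
  by move/(_ zeta); rewrite eqxx.
apply: eq_big => [zeta|zeta _].
  rewrite addpE eqxx addn1; case: pickP => [z /eqP zE|].
    by rewrite (addp_inj _ _ _ zE) eqxx.
  by move/(_ zeta); rewrite eqxx.
by rewrite mulrA addpE eqxx addn1 weight_addp.
Qed.

Lemma sum_weight_gen {M} (f G : config L M.+1 -> R) :
  \sum_eta w eta * (gen rate f eta * G eta)
  = \sum_zeta w zeta * (L%:R^-1 *
      \sum_x (\sum_y (f (addp zeta y) - f (addp zeta x))) * G (addp zeta x)).
Proof.
transitivity (L%:R^-1 * \sum_x \sum_eta w eta * (rate x (eta x) *
    ((\sum_y grad x y f eta) * G eta))).
  rewrite exchange_big mulr_sumr; apply: eq_bigr => eta _.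
  rewrite -mulr_sumr [RHS]mulrCA; congr (_ * _).
  rewrite /gen -mulrA; congr (_ * _); rewrite mulr_suml; apply: eq_bigr => x _.
  by rewrite -mulr_sumr mulrA.
under eq_bigr do rewrite sum_weight_addp.
rewrite exchange_big mulr_sumr; apply: eq_bigr => zeta _.
rewrite -mulr_sumr [LHS]mulrCA; congr (_ * (_ * _)); apply: eq_bigr => x _.
by congr (_ * _); apply: eq_bigr => y _; rewrite /grad move_addp.
Qed.

Lemma gen0 (f : config L 0 -> R) eta : gen rate f eta = 0.
Proof.
rewrite /gen big1 ?mulr0// => x _; rewrite big1// => y _.
by rewrite rate_config0 mul0r.
Qed.

(** Here the particle at [u] belongs to the background [zeta] of the one at [x]. Taking
it away too leaves a background of [N - 2] particles, over which the
configurations involved only differ by the sites of the two particles. *)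
Lemma two_particle_sum_ge0 {M} (f : config L M.+1 -> R) :
  (forall eta, 0 < f eta) ->
  0 <= \sum_(zeta : config L M) w zeta *
    \sum_x (\sum_y (f (addp zeta y) - f (addp zeta x))) *
    \sum_u rate u (zeta u) * \sum_v (grad u v (fun eta => ln (f eta)) (addp zeta x)
        + grad u v f (addp zeta x) / f (addp zeta x)).
Proof.
move=> f0; case: M f f0 => [|M] f f0.
  rewrite sumr_ge0// => zeta _; rewrite big1 ?mulr0// => x _.
  rewrite [X in _ * X]big1 ?mulr0// => u _.
  by rewrite rate_config0 mul0r.
pose A x (zeta : config L M.+1) := \sum_y (f (addp zeta y) - f (addp zeta x)).
pose B x u (zeta : config L M.+1) :=
  \sum_v (grad u v (fun eta => ln (f eta)) (addp zeta x)
        + grad u v f (addp zeta x) / f (addp zeta x)).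
rewrite [leRHS](_ : _ = \sum_x \sum_u \sum_(zeta : config L M.+1)
    w zeta * (rate u (zeta u) * (A x zeta * B x u zeta))); last first.
  under [RHS]eq_bigr do rewrite exchange_big.
  rewrite [RHS]exchange_big; apply: eq_bigr => zeta _ /=.
  rewrite mulr_sumr; apply: eq_bigr => x _; rewrite -mulr_sumr; congr (_ * _).
  by rewrite mulr_sumr; apply: eq_bigr => u _; rewrite mulrCA.
under eq_bigr do under eq_bigr do rewrite sum_weight_addp.
under eq_bigr do rewrite exchange_big.
rewrite exchange_big sumr_ge0// => xi _ /=.
under eq_bigr do rewrite -mulr_sumr.
rewrite -mulr_sumr mulr_ge0 ?(ltW (weight_gt0 xi))//.
have := two_particle_ge0 _ (fun x u => f (addp (addp xi x) u)) (fun x u => f0 _).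
(* x and u are the sites of the two particles over xi; addpC lets either of them
   be the one that moves. *)
congr (0 <= _); apply: eq_bigr => x _; rewrite exchange_big; apply: eq_bigr => u _.
rewrite mulr_suml; apply: eq_bigr => y _ /=; rewrite -mulr_sumr.
rewrite (addpC xi y) !(addpC xi x u); congr (_ * _).
by apply: eq_bigr => v _; rewrite /grad !(addpC xi u x) move_addp.
Qed.

Lemma dirichlet_addp {M} (f g : config L M.+1 -> R) :
  dirichlet rate f g = (partition_fun M.+1 rate)^-1 *
    \sum_(zeta : config L M) w zeta * (L%:R^-1 *
      \sum_x f (addp zeta x) * \sum_y (g (addp zeta x) - g (addp zeta y))).
Proof.
rewrite /dirichlet /expect; under eq_bigr do rewrite -mulrA [f _ * _]mulrC.
rewrite -mulr_sumr sum_weight_gen -mulrN -sumrN; congr (_ * _).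
apply: eq_bigr => zeta _; rewrite -!mulrN -sumrN; congr (_ * (_ * _)).
apply: eq_bigr => x _; rewrite mulrC -mulrN -sumrN; congr (_ * _).
by apply: eq_bigr => y _; rewrite opprB.
Qed.

(** The convexity inequality. After a particle is taken away, the term where the same
particle jumps in both generators is the one-particle inequality over each
background, and the term where a second particle jumps is nonnegative. *)
Lemma bochner_ineq (c delta : R) N (f : config L N -> R) :
  (0 < L)%N -> 0 <= delta -> delta <= c ->
  (forall x n, c <= rate x n.+1 - rate x n <= c + delta) ->
  (forall eta, 0 < f eta) ->
  let logf := fun eta => ln (f eta) in
  c * dirichlet rate f logf <=
    expect rate (fun eta => gen rate f eta * gen rate logf eta)
    + expect rate (fun eta => (gen rate f eta) ^+ 2 / f eta).
Proof.
move=> L0 d0 dc incr f0 /=; set logf := fun eta => ln (f eta).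
case: N f f0 @logf => [|M] f f0 logf.
  rewrite /dirichlet /expect !big1 ?oppr0 ?mulr0 ?addr0// => eta _;
    by rewrite !gen0 ?expr0n ?mul0r !mulr0.
have Z0 : 0 <= (partition_fun M.+1 rate)^-1.
  by rewrite invr_ge0 sumr_ge0// => eta _; rewrite ltW ?weight_gt0.
have Lr0 : 0 < L%:R :> R by rewrite ltr0n.
pose B u (eta : config L M.+1) := \sum_v (grad u v logf eta + grad u v f eta / f eta).
pose H (eta : config L M.+1) := L%:R^-1 * \sum_u rate u (eta u) * B u eta.
have HE eta : gen rate logf eta + gen rate f eta / f eta = H eta.
  rewrite /gen -mulrA -mulrDr mulr_suml -big_split; congr (_ * _).
  apply: eq_bigr => u _; rewrite /B mulr_suml -big_split mulr_sumr.
  by apply: eq_bigr => v _ /=; rewrite [RHS]mulrDr mulrA.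
rewrite dirichlet_addp /expect -big_split/=.
rewrite [leRHS](eq_bigr (fun eta => (partition_fun M.+1 rate)^-1 *
    (w eta * (gen rate f eta * H eta)))); last first.
  by move=> eta _; rewrite -HE /zr_measure; ring.
rewrite -mulr_sumr mulrCA ler_wpM2l// sum_weight_gen.
pose A x (zeta : config L M) := \sum_y (f (addp zeta y) - f (addp zeta x)).
pose a x (zeta : config L M) := rate x (zeta x).+1 - rate x (zeta x).
(* The particle that has just been added to x feels the increment a x zeta on top
   of the rate of the background. *)
have HaddE zeta x : H (addp zeta x) = L%:R^-1 *
    (a x zeta * B x (addp zeta x) + \sum_u rate u (zeta u) * B u (addp zeta x)).
  rewrite /H; congr (_ * _); rewrite (bigD1 x)//= [in RHS](bigD1 x)//= addrA.
  rewrite addpE eqxx addn1 -mulrDl subrK; congr (_ + _).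
  by apply: eq_bigr => u /negbTE ux; rewrite addpE ux addn0.
rewrite [leRHS](_ : _ = \sum_(zeta : config L M) w zeta * (L%:R^-1 ^+ 2 *
      \sum_x a x zeta * (A x zeta * B x (addp zeta x)))
    + L%:R^-1 ^+ 2 * \sum_(zeta : config L M) w zeta *
      \sum_x A x zeta * \sum_u rate u (zeta u) * B u (addp zeta x)); last first.
  rewrite mulr_sumr -big_split; apply: eq_bigr => zeta _ /=.
  rewrite [X in _ + X]mulrCA -mulrDr -mulrDr; congr (_ * _).
  rewrite expr2 -mulrA; congr (_ * _).
  rewrite -big_split mulr_sumr; apply: eq_bigr => x _ /=.
  by rewrite HaddE -/(A x zeta); ring.
rewrite -[leLHS]addr0 lerD//; last first.
  by rewrite mulr_ge0 ?sqr_ge0//; exact: two_particle_sum_ge0.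
rewrite mulr_sumr ler_sum// => zeta _; rewrite mulrCA ler_wpM2l ?(ltW (weight_gt0 _))//.
have := one_particle_ge _ (fun x => f (addp zeta x)) (fun x => a x zeta) c delta.
rewrite card_ord => /(_ L0 (fun=> f0 _) d0 dc (fun=> incr _ _)) le1.
rewrite -(ler_pM2l (exprn_gt0 2 Lr0)) mulrA.
rewrite [leLHS](_ : _ = c * L%:R * \sum_x f (addp zeta x) *
    \sum_y (logf (addp zeta x) - logf (addp zeta y))); last first.
  by field; rewrite gt_eqF.
rewrite mulrA -exprMn mulfV ?gt_eqF// expr1n mul1r.
apply: (le_trans le1); rewrite ler_sum// => x _.
rewrite /A /B /grad; under [X in _ <= _ * (_ * X)]eq_bigr do rewrite move_addp.
by [].
Qed.

(** * The zero-range process as a reversible Markov chain *)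

Definition jump_rate {N} (eta eta' : config L N) : R :=
  L%:R^-1 * \sum_x \sum_y rate x (eta x) * (move eta x y == eta')%:R.

Lemma gen_markov {N} (f : config L N -> R) :
  gen rate f = markov_gen jump_rate f.
Proof.
apply/funext => eta; rewrite /gen /markov_gen /jump_rate.
under [RHS]eq_bigr do rewrite -mulrA mulr_suml.
rewrite -[RHS]mulr_sumr; congr (_ * _).
rewrite [RHS]exchange_big; apply: eq_bigr => x _ /=.
under [RHS]eq_bigr do rewrite mulr_suml.
rewrite [RHS]exchange_big; apply: eq_bigr => y _ /=.
rewrite (bigD1 (move eta x y))//= eqxx mulr1 big1 ?addr0// => eta' ne.
by rewrite eq_sym (negbTE ne) mulr0 mul0r.
Qed.

Lemma jump_rate_ge0 {N} (eta eta' : config L N) : 0 <= jump_rate eta eta'.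
Proof.
rewrite mulr_ge0 ?invr_ge0// sumr_ge0// => x _; rewrite sumr_ge0// => y _.
by rewrite mulr_ge0 ?rate_nonneg.
Qed.

Lemma jump_rate_gt0 {N} (eta : config L N) x y :
  eta x != 0%N -> 0 < jump_rate eta (move eta x y).
Proof.
move=> ex.
have t0 u v : 0 <= rate u (eta u) * (move eta u v == move eta x y)%:R.
  by rewrite mulr_ge0 ?rate_nonneg.
rewrite mulr_gt0 ?invr_gt0 ?ltr0n ?(leq_ltn_trans _ (ltn_ord x))//.
rewrite (bigD1 x)//= (bigD1 y)//= eqxx mulr1 -addrA.
rewrite ltr_pwDl ?rate_gt0 ?lt0n// addr_ge0 ?sumr_ge0// => u _.
by rewrite sumr_ge0.
Qed.

(** Up to the same normalising factor, each side sums the weight of [zeta] over the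
backgrounds [zeta] and the sites [x] and [y] such that [eta] is [zeta + x] and
[eta'] is [zeta + y]. *)
Lemma detailed_balance {N} (eta eta' : config L N) :
  zr_measure rate eta * jump_rate eta eta'
  = zr_measure rate eta' * jump_rate eta' eta.
Proof.
rewrite /zr_measure -!mulrA; congr (_ * _).
case: N eta eta' => [|M] eta eta'.
  have z (e e' : config L 0) : jump_rate e e' = 0.
    rewrite /jump_rate big1 ?mulr0// => x _; rewrite big1// => y _.
    by rewrite rate_config0 mul0r.
  by rewrite !z !mulr0.
have E (e e' : config L M.+1) : w e * jump_rate e e' = L%:R^-1 *
    \sum_x \sum_y \sum_zeta w zeta * ((addp zeta x == e) && (addp zeta y == e'))%:R.
  rewrite mulrCA mulr_sumr; congr (_ * _); apply: eq_bigr => x _.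
  rewrite mulr_sumr; apply: eq_bigr => y _.
  transitivity (\sum_s w s * (rate x (s x) * ((s == e) && (move s x y == e'))%:R)).
    rewrite (bigD1 e)//= eqxx big1 ?addr0// => s /negbTE->.
    by rewrite !mulr0.
  rewrite (sum_weight_addp x (fun s => ((s == e) && (move s x y == e'))%:R)).
  by apply: eq_bigr => zeta _; rewrite move_addp.
rewrite !E; congr (_ * _); rewrite exchange_big; apply: eq_bigr => x _.
by apply: eq_bigr => y _; apply: eq_bigr => zeta _; rewrite andbC.
Qed.

End ZeroRange.

Theorem theorem4p2 (R : realType) (L : nat) (rate : 'I_L -> nat -> R)
    (c delta : R)
    (L_ge1 : (1 <= L)%N)
    (rate_ge0 : forall x n, 0 <= rate x n)
    (rate0 : forall x, rate x 0%N = 0)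
    (rate_gt0 : forall x n, (0 < n)%N -> 0 < rate x n)
    (delta_ge0 : 0 <= delta) (delta_lt : delta < c)
    (rate_incr : forall x n, c <= rate x n.+1 - rate x n <= c + delta)
    (N : nat) (f : config L N -> R) (f_gt0 : forall eta, 0 < f eta) :
  let logf := fun eta => ln (f eta) in
  (c - delta) * dirichlet rate f logf <=
    expect rate (fun eta => gen rate f eta * gen rate logf eta)
    + expect rate (fun eta => (gen rate f eta) ^+ 2 / f eta)
  /\ (c - delta) * entropy rate f <= dirichlet rate f logf.
Proof.
move=> logf.
pose p := @zr_measure R L N rate; pose Q := @jump_rate R L rate N.
have p_gt0 eta : 0 < p eta by exact: zr_measure_gt0.
have p_sum : \sum_eta p eta = 1 by exact: sum_zr_measure.
have Q_ge0 eta eta' : 0 <= Q eta eta' by exact: jump_rate_ge0.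
have Q_rev eta eta' : p eta * Q eta eta' = p eta' * Q eta' eta.
  exact: detailed_balance.
have dirichlet_markov (g : config L N -> R) :
    dirichlet rate g (fun eta => ln (g eta)) = entropy_production p Q g.
  by rewrite /dirichlet gen_markov.
have decay (g : config L N -> R) : (forall eta, 0 < g eta) ->
    (c - delta) * entropy_production p Q g <= production_decay p Q g.
  move=> g_gt0; rewrite -dirichlet_markov /production_decay -!gen_markov.
  have := bochner_ineq rate rate0 rate_gt0 c delta N g L_ge1 delta_ge0 (ltW delta_lt)
    rate_incr g_gt0.
  apply: le_trans; rewrite ler_wpM2r ?gerBl// dirichlet_markov.
  exact: entropy_production_ge0.
rewrite dirichlet_markov; split.
  by have := decay f f_gt0; rewrite /production_decay -!gen_markov.
apply: modified_log_sobolev => // g gQ; apply: config_move_const => //.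
by move=> eta x y ex; apply: gQ; exact: jump_rate_gt0.
Qed.
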